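(* Let $k_1,k_2$ be positive rational numbers with $k_1+k_2\neq1$. There exist a constant $C>0$ and a positive integer $M=M(k_1,k_2)$, divisible by the denominators of $k_1$ and $k_2$, such that for all $0<\alpha<1/2$ there is $N_0=N_0(\alpha,k_1,k_2)$ such that the following holds for every finite abelian group $G$ of order $N>N_0$ with $\gcd(N,M)=1$: there exists $S\subseteq G\times G$ with $|S|\ge\alpha|G|^2$ such that for every nonzero $d\in G$, \[\mathbb{E}_{x,y\in G}\mathbbm{1}_S(x,y)\mathbbm{1}_S(x+d,y)\mathbbm{1}_S(x,y+d)\mathbbm{1}_S(x+k_1d,y+k_2d)<\alpha^5e^{C\sqrt{\log(1/\alpha)}}.\]
   Context: For a rational $k=a/b$ (in lowest terms, $b>0$) and an element $d$ of a finite abelian group $G$ with $\gcd(b,|G|)=1$, $kd$ denotes the unique $e\in G$ with $be=ad$. $\mathbb{E}_{x,y\in G}$ denotes the average over $(x,y)\in G\times G$ uniformly, and $\mathbbm{1}_S$ is the indicator function of $S$. *)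

(* Defs.v *)
From HB Require Import structures.
From mathcomp Require Import all_boot all_order all_fingroup all_algebra.
From mathcomp Require Import cyclic reals.
Set Implicit Arguments.
Unset Strict Implicit.
Unset Printing Implicit Defensive.
Import Order.TTheory GRing.Theory Num.Theory.
Local Open Scope ring_scope.

Definition average (R : realType) (T : finType) (f : T -> R) : R :=
  (\sum_(t : T) f t) / #|T|%:R.

Definition indicator (R : realType) (T : finType) (S : {set T}) (t : T) : R :=
  (t \in S)%:R.

(* For k = a / b in lowest terms, the e with b e = a d.  It is unique when b
   is coprime to the order of G (ratmulP, ratmul_uniq); 0 is only a default
   for the case where no such e exists. *)
Definition ratmul (G : finZmodType) (k : rat) (d : G) : G :=
  odflt 0 [pick e : G | e *~ denq k == d *~ numq k].

Lemma mulrz_denq_inj (G : finZmodType) (k : rat) :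
  coprime `|denq k| #|G| -> injective (fun e : G => e *~ denq k).
Proof.
move=> cop e1 e2; rewrite -[denq k]gez0_abs ?denq_ge0 // -!pmulrn -!FinRing.zmodXgE.
have coG : coprime #|[set: G]| `|denq k| by rewrite coprime_sym cardsT.
by move/(congr1 (fun x => natexp x (expg_invn [set: G] `|denq k|)));
  rewrite !(expgK coG) ?inE.
Qed.

Lemma ratmulP (G : finZmodType) (k : rat) (d : G) :
  coprime `|denq k| #|G| -> ratmul k d *~ denq k = d *~ numq k.
Proof.
move=> cop; rewrite /ratmul; case: pickP => [e /eqP //|none].
have [g _ gK] := injF_bij (mulrz_denq_inj cop).
by have := none (g (d *~ numq k)); rewrite gK eqxx.
Qed.

Lemma ratmul_uniq (G : finZmodType) (k : rat) (d e : G) :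
  coprime `|denq k| #|G| -> e *~ denq k = d *~ numq k -> e = ratmul k d.
Proof.
by move=> cop De; apply: (mulrz_denq_inj cop); rewrite /= De ratmulP.
Qed.

(* Main.v *)
Require Import Defs.
From HB Require Import structures.
From mathcomp Require Import all_boot all_order all_fingroup all_algebra.
From mathcomp Require Import cyclic reals sequences exp.
From mathcomp Require Import ring lra zify.
Import Order.TTheory GRing.Theory Num.Theory.
Local Open Scope ring_scope.

(* Take S to be the set of (x, y) with (f x, g y, h (x + y)) in F, where f, g, h
   are random maps from G to a finite set A of size n, and F is a set of triples
   (a, b, c) containing no "triforce" (a, b, c), (a', b, c'), (a, b', c') apart
   from those with a' = a, b' = b, c' = c, and in which (a, b) determines c.
   A corner in S is a triforce in F, so it forces f (x + d) = f x,
   g (y + d) = g y and h (x + y + d) = h (x + y) = c (f x, g y); as (k1 + k2) d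
   is neither 0 nor d, the fourth point forces one more value of h.  Hence each
   d contributes at most n^-5 in expectation, while S has expected density
   |F| / n^3.  Behrend's sphere construction in a grid [3 r]^k with r = 2^k
   gives n >= 2^(k^2) and |F| / n^3 >= 2^-(k^2 + 8 k).  All these quantities
   have bounded differences O(1/N), so McDiarmid's inequality and a union bound
   over the N values of d give a suitable choice of f, g, h. *)

(** * Uniform averages over finite types, and a Hoeffding-type bound *)

Section Average.
Set Implicit Arguments.
Unset Strict Implicit.
Variable R : realType.
Implicit Types T U : finType.

Lemma eq_average T (f g : T -> R) : f =1 g -> average f = average g.
Proof. by move=> fg; rewrite /average (eq_bigr g). Qed.

Lemma ler_average T (f g : T -> R) :
  (forall t, f t <= g t) -> average f <= average g.
Proof.
by move=> fg; rewrite /average ler_wpM2r ?invr_ge0 ?ler0n // ler_sum.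
Qed.

Lemma average_cst T (c : R) : (0 < #|T|)%N -> average (fun _ : T => c) = c.
Proof.
by move=> T0; rewrite /average sumr_const -[c *+ _]mulr_natr mulfK // pnatr_eq0 -lt0n.
Qed.

Lemma averageZ T (c : R) (f : T -> R) :
  average (fun t => c * f t) = c * average f.
Proof. by rewrite /average -mulr_sumr mulrA. Qed.

Lemma averageZr T (c : R) (f : T -> R) :
  average (fun t => f t * c) = average f * c.
Proof. by rewrite mulrC -averageZ; apply: eq_average => t; rewrite mulrC. Qed.

Lemma averageD T (f g : T -> R) :
  average (fun t => f t + g t) = average f + average g.
Proof. by rewrite /average big_split mulrDl. Qed.

Lemma averageB T (f g : T -> R) :
  average (fun t => f t - g t) = average f - average g.
Proof. by rewrite /average sumrB mulrBl. Qed.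

Lemma average_sum T (U : finType) (P : pred U) (f : U -> T -> R) :
  average (fun t => \sum_(u | P u) f u t) = \sum_(u | P u) average (f u).
Proof. by rewrite /average exchange_big /= mulr_suml. Qed.

Lemma exchange_average T U (f : T -> U -> R) :
  average (fun t => average (f t)) = average (fun u => average (f^~ u)).
Proof.
rewrite /average -!mulr_suml exchange_big /= -!mulrA.
by congr (_ * _); rewrite mulrC.
Qed.

Lemma ler_norm_average T (f : T -> R) :
  `|average f| <= average (fun t => `|f t|).
Proof.
rewrite /average normrM [`|_^-1|]ger0_norm ?invr_ge0 ?ler0n //.
by rewrite ler_wpM2r ?invr_ge0 ?ler0n // ler_norm_sum.
Qed.

Lemma reindex_average T (h : T -> T) (f : T -> R) :
  injective h -> average (fun t => f (h t)) = average f.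
Proof.
by move=> hi; rewrite /average [in RHS](reindex_inj hi).
Qed.

Lemma average_prod T U (f : T * U -> R) :
  average f = average (fun t => average (fun u => f (t, u))).
Proof.
rewrite /average -mulr_suml pair_big /= card_prod natrM invfM mulrA mulrAC.
by congr (_ / _ / _); apply: eq_bigr => -[].
Qed.

Lemma average_lt1 T (f : T -> R) : (0 < #|T|)%N ->
  average f < 1 -> exists t, f t < 1.
Proof.
move=> T0 f1; case: (pickP (fun t => f t < 1)) => [t|none]; first by exists t.
case/negP: (negbT (lt_irreflexive (1 : R))); apply: le_lt_trans f1.
rewrite -[X in X <= _](@average_cst T 1 T0); apply: ler_average => t.
by rewrite leNgt none.
Qed.

Lemma average_eq1 T (t0 : T) : average (fun t => (t == t0)%:R : R) = #|T|%:R^-1.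
Proof.
rewrite /average (bigD1 t0) //= eqxx big1 ?addr0 ?mul1r // => t /negbTE ->.
by [].
Qed.

(** Since [1 - u <= expR (- u)], it is enough that [(1 + u + 2 u^2) (1 - u) = 1 + u^2 (1 - 2 u)] is
    at least 1. *)
Lemma expR_quadratic_ub (u : R) : `|u| <= 2^-1 -> expR u <= 1 + u + 2 * u ^+ 2.
Proof.
rewrite ler_norml => /andP[u1 u2].
have h : 0 < 1 - u by lra.
have : 1 - u <= expR (- u) by have := expR_ge1Dx (- u).
rewrite expRN => hu; have e0 := expR_gt0 u.
have {hu} : expR u * (1 - u) <= 1.
  by rewrite -[X in _ <= X](divff (lt0r_neq0 e0)) ler_wpM2l // ltW.
move=> hu; rewrite -(ler_pM2r h); apply: le_trans hu _.
have : 0 <= u ^+ 2 * (1 - 2 * u) by rewrite mulr_ge0 ?sqr_ge0 //; lra.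
nra.
Qed.

(** After centring at the mean, the linear term of the quadratic bound averages to zero, which
    leaves [1 + 2 c^2 <= expR (2 c^2)]. *)
Lemma average_expR_ub T (y : T -> R) (c : R) : (0 < #|T|)%N -> c <= 2^-1 ->
    (forall a b, `|y a - y b| <= c) ->
  average (fun a => expR (y a)) <= expR (2 * c ^+ 2) * expR (average y).
Proof.
move=> T0 c2 yc; set m := average y.
have ym a : `|y a - m| <= c.
  rewrite -[y a](@average_cst T) // /m -averageB.
  apply: le_trans (ler_norm_average _) _.
  by rewrite -[c](@average_cst T) //; apply: ler_average.
under eq_average => a do rewrite -[y a](subrK m) expRD.
rewrite averageZr ler_wpM2r ?expR_ge0 //.
apply: (@le_trans _ _ (average (fun a => 1 + 2 * c ^+ 2 + (y a - m)))).
  apply: ler_average => a; apply: le_trans (expR_quadratic_ub _) _.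
    exact: le_trans (ym a) c2.
  have : (y a - m) ^+ 2 <= c ^+ 2.
    by move: (ym a); rewrite ler_norml => /andP[]; nra.
  lra.
rewrite averageD averageB !average_cst // subrr addr0.
exact: expR_ge1Dx.
Qed.

End Average.

(** * Product spaces: averaging out coordinates, and McDiarmid's inequality *)

Section BoundedDifferences.
Set Implicit Arguments.
Unset Strict Implicit.
Variables (R : realType) (I A : finType).
Implicit Types (w : {ffun I -> A}) (p q : I) (a b : A).
Implicit Types (phi : {ffun I -> A} -> R) (s : seq I) (c : R).

Definition update w p a : {ffun I -> A} :=
  [ffun q => if q == p then a else w q].

Lemma updateE w p a q : update w p a q = if q == p then a else w q.
Proof. by rewrite ffunE. Qed.

Lemma update_update w p a b : update (update w p a) p b = update w p b.
Proof. by apply/ffunP => q; rewrite !updateE; case: eqP. Qed.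

Lemma update_id w p : update w p (w p) = w.
Proof. by apply/ffunP => q; rewrite !updateE; case: eqP => [->|]. Qed.

Lemma updateC w p q a b : p != q ->
  update (update w p a) q b = update (update w q b) p a.
Proof.
move=> pq; apply/ffunP => i; rewrite !updateE.
by case: (eqVneq i q) => // ->; rewrite eq_sym (negbTE pq).
Qed.

(** Conditional expectation given the coordinates other than [p], kept as a function on the full
    product so that it can be iterated. *)
Definition marginal p phi w : R := average (fun a => phi (update w p a)).

Lemma average_marginal p phi : (0 < #|A|)%N ->
  average (marginal p phi) = average phi.
Proof.
move=> A0; rewrite -[RHS](@eq_average _ _ (fun w => average (fun _ : A => phi w)));
  last by move=> w; rewrite average_cst.
rewrite /marginal -(average_prod (fun t => phi (update t.1 p t.2))).
rewrite -(average_prod (fun t : {ffun I -> A} * A => phi t.1)).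
(* Exchanging the fresh value [a] with the old value [w p] is an involution of the pairs
   [(w, a)]. *)
rewrite -[RHS](@reindex_average _ _ (fun t => (update t.1 p t.2, t.1 p))) //.
apply: (can_inj (g := fun t => (update t.1 p t.2, t.1 p))) => -[w a] /=.
by rewrite update_update update_id updateE eqxx.
Qed.

(** Independence: [w p] is uniform whatever the other coordinates are, and [v] and [phi] read only
    those. *)
Lemma average_determined p (v : {ffun I -> A} -> A) phi :
    (0 < #|A|)%N ->
    (forall w a, v (update w p a) = v w) ->
    (forall w a, phi (update w p a) = phi w) ->
  average (fun w => (w p == v w)%:R * phi w) = #|A|%:R^-1 * average phi.
Proof.
move=> A0 vp phip; rewrite -(average_marginal p) // -averageZ.
apply: eq_average => w; rewrite /marginal -(average_eq1 R (v w)) -averageZr.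
by apply: eq_average => a; rewrite vp phip updateE eqxx.
Qed.

Definition bounded_diff c phi :=
  forall w p a, `|phi (update w p a) - phi w| <= c.

Definition marginals s phi := foldr marginal phi s.

Lemma bounded_diff_marginal c p phi : (0 < #|A|)%N ->
  bounded_diff c phi -> bounded_diff c (marginal p phi).
Proof.
move=> A0 phic w q b; rewrite /marginal -averageB.
apply: le_trans (ler_norm_average _) _.
rewrite -[c](@average_cst _ A) //; apply: ler_average => a.
have [->|qp] := eqVneq q p; last by rewrite updateC.
by rewrite update_update subrr normr0; apply: le_trans (phic w p b).
Qed.

Lemma bounded_diff_marginals c s phi : (0 < #|A|)%N ->
  bounded_diff c phi -> bounded_diff c (marginals s phi).
Proof.
by move=> A0 phic; elim: s => //= p s; apply: bounded_diff_marginal.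
Qed.

Lemma average_marginals s phi : (0 < #|A|)%N ->
  average (marginals s phi) = average phi.
Proof. by move=> A0; elim: s => //= p s; rewrite average_marginal. Qed.

Lemma marginals_update s phi w p a : p \in s ->
  marginals s phi (update w p a) = marginals s phi w.
Proof.
elim: s w => //= q s IH w; rewrite inE; have [->|pq] /= := eqVneq p q => ps.
  by apply: eq_average => b; rewrite update_update.
by apply: eq_average => b; rewrite updateC // IH.
Qed.

Lemma marginals_enum phi w : (0 < #|A|)%N ->
  marginals (enum I) phi w = average phi.
Proof.
move=> A0; rewrite -(average_marginals (enum I)) //.
rewrite -[LHS](@average_cst _ {ffun I -> A}) //;
  last by apply/card_gt0P; exists w.
apply: eq_average => w'.
(* Overwriting [w] by [w'] one coordinate at a time never changes the full marginal, so it is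
   constant and equals its own average. *)
suff H s : marginals (enum I) phi
    (foldr (fun p u => update u p (w' p)) w s) = marginals (enum I) phi w.
  rewrite -(H (enum I)); congr marginals; apply/ffunP => i.
  have : i \in enum I by rewrite mem_enum.
  elim: (enum I) => //= p s IH; rewrite inE updateE.
  by case: eqVneq => [->|].
by elim: s => //= p s IH; rewrite marginals_update ?mem_enum.
Qed.

(* Exponential-moment form of McDiarmid's inequality: averaging out one
   coordinate at a time costs a factor exp (2 c^2). *)
Lemma mcdiarmid_expR c phi : (0 < #|A|)%N -> c <= 2^-1 -> bounded_diff c phi ->
  average (fun w => expR (phi w))
    <= expR (2 * c ^+ 2 * #|I|%:R) * expR (average phi).
Proof.
move=> A0 c2 phic.
have H s w : marginals s (fun w => expR (phi w)) w
    <= expR (2 * c ^+ 2 * (size s)%:R) * expR (marginals s phi w).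
  elim: s w => [|p s IH] w /=; first by rewrite mulr0 expR0 mul1r.
  apply: le_trans (ler_average (fun a => IH (update w p a))) _.
  rewrite averageZ -[(size s).+1%:R]natr1 mulrDr mulr1 expRD -[leRHS]mulrA.
  rewrite ler_wpM2l ?expR_ge0 //; apply: average_expR_ub => // a b.
  rewrite -(update_update w p b a); exact: bounded_diff_marginals.
have /card_gt0P[a0 _] := A0.
have := H (enum I) [ffun=> a0].
by rewrite !marginals_enum // -cardE.
Qed.

End BoundedDifferences.

(** * Behrend-type sets of triples with only trivial triforces *)

Section Behrend.
Set Implicit Arguments.
Unset Strict Implicit.

Definition grid (k q : nat) := {ffun 'I_k -> 'I_q}.

Definition sqdist (k q : nat) (a b : grid k q) : int :=
  \sum_i ((b i)%:Z - (a i)%:Z) ^+ 2.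

(** The sphere condition bears on the common difference, not on the points, so the base point of the
    progression stays free. *)
Definition sphere_prog (k q : nat) (r : int) (a b c : grid k q) : bool :=
  [forall i, (a i + c i == 2 * b i)%N] && (sqdist a b == r).

Lemma sphere_prog_third k q r (a b c c' : grid k q) :
  sphere_prog r a b c -> sphere_prog r a b c' -> c' = c.
Proof.
move=> /andP[/forallP h _] /andP[/forallP h' _]; apply/ffunP => i; apply/val_inj.
by move: (h i) (h' i) => /=; lia.
Qed.

(* The parallelogram law: c' - b and b - a lie on the same sphere, and so does
   half of their sum, hence they are equal. *)
Lemma sphere_prog_triforce k q r (a b c a' b' c' : grid k q) :
  sphere_prog r a b c -> sphere_prog r a' b c' -> sphere_prog r a b' c' ->
  [/\ a' = a, b' = b & c' = c].
Proof.
move=> /andP[/forallP h1 /eqP d1] /andP[/forallP h2 /eqP d2].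
move=> /andP[/forallP h3 /eqP d3].
pose u i := (b i)%:Z - (a i)%:Z; pose v i := (c' i)%:Z - (b i)%:Z.
have uv0 : \sum_i (u i - v i) ^+ 2 = 0.
  have -> : \sum_i (u i - v i) ^+ 2
      = 2 * sqdist a b + 2 * sqdist a' b - 4 * sqdist a b'.
    rewrite /sqdist !mulr_sumr -big_split -sumrB /=; apply: eq_bigr => i _.
    move: (h2 i) (h3 i); rewrite /u /v => /eqP e2 /eqP e3.
    have -> : (c' i)%:Z = 2 * (b' i)%:Z - (a i)%:Z by lia.
    have -> : (a' i)%:Z = 2 * (b i)%:Z - (2 * (b' i)%:Z - (a i)%:Z) by lia.
    ring.
  by rewrite d1 d2 d3; ring.
have uv i : u i = v i.
  move/eqP: uv0; rewrite psumr_eq0; last by move=> j _; exact: sqr_ge0.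
  by move/allP/(_ i (mem_index_enum i)); rewrite /= sqrf_eq0 subr_eq0 => /eqP.
split; apply/ffunP => i; apply/val_inj; move: (uv i) (h1 i) (h2 i) (h3 i);
  rewrite /u /v /=; lia.
Qed.

(** Pigeonhole: the [r ^ k] grid points have fewer than [k * r ^ 2 + 1] possible squared norms. *)
Lemma popular_sphere k r : (0 < k)%N -> (0 < r)%N ->
  exists m : nat,
    (r ^ k <= k * r ^ 2 * #|[set l : grid k r | \sum_i l i ^ 2 == m]|)%N.
Proof.
move=> k0 r0; pose f (l : grid k r) := (\sum_i l i ^ 2)%N.
have fk l : (f l < k * r ^ 2)%N.
  rewrite /f; apply: (@leq_ltn_trans (k * r.-1 ^ 2)).
    rewrite -[X in (_ <= X * _)%N]card_ord -sum_nat_const; apply: leq_sum => i _.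
    by rewrite leq_exp2r //; have := ltn_ord (l i); lia.
  by rewrite ltn_pmul2l // ltn_exp2r //; lia.
case: (pickP (fun m : 'I_(k * r ^ 2) =>
    r ^ k <= k * r ^ 2 * #|[set l : grid k r | f l == m]|)%N) => [m hm|none].
  by exists m.
have : (\sum_(m < k * r ^ 2) #|[set l : grid k r | f l == m]| = r ^ k)%N.
  rewrite -[RHS](_ : #|grid k r| = _); last by rewrite card_ffun !card_ord.
  rewrite -sum1_card (partition_big (fun l => Ordinal (fk l)) predT) //=.
  apply: eq_bigr => m _; rewrite sum1_card cardsE; apply: eq_card => l.
  by rewrite -!topredE.
have kr : (0 < k * r ^ 2)%N by rewrite muln_gt0 k0 expn_gt0 r0.
move=> /(congr1 (muln (k * r ^ 2))); rewrite big_distrr /= => E.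
suff : (\sum_(m < k * r ^ 2) k * r ^ 2 * #|[set l : grid k r | f l == m]|
        < \sum_(m < k * r ^ 2) r ^ k)%N.
  by rewrite E sum_nat_const card_ord ltnn.
rewrite (bigD1 (Ordinal kr)) //= [X in (_ < X)%N](bigD1 (Ordinal kr)) //=.
rewrite -addSn leq_add //; first by rewrite ltnNge (none (Ordinal kr)).
by apply: leq_sum => m _; rewrite ltnW // ltnNge (none m).
Qed.

(** A base point [a] and a difference [l] in the grid of side [r] give [a], [a + l], [a + 2 l],
    which fits in side [3 r]; the pair is recovered from the first two terms. *)
Lemma card_sphere_prog k r m :
  (r ^ k * #|[set l : grid k r | \sum_i l i ^ 2 == m]| <=
   #|[set t : grid k (3 * r) * grid k (3 * r) * grid k (3 * r) |
        sphere_prog m%:Z t.1.1 t.1.2 t.2]|)%N.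
Proof.
(* For [r = 0] there is no point to serve as the default of [insubd]. Below, that default is never
   reached. *)
case: r => [|r].
  case: k => [|k]; last by rewrite exp0n.
  rewrite expn0 mul1n; set s := [set l | _] ; set s' := [set t | _].
  pose f (l : grid 0 0) := (l, l, l).
  have fi : injective f by move=> x y [].
  rewrite -(card_imset (mem s) fi); apply/subset_leq_card/subsetP => t.
  case/imsetP => l; rewrite !inE big_ord0 => /eqP <- ->.
  by rewrite /sphere_prog /sqdist big_ord0 andbT; apply/forallP => -[].
set q := (3 * r.+1)%N; set s := [set l | _].
have ub (x y : 'I_r.+1) (j : nat) : (j <= 2)%N -> (x + j * y < q)%N.
  by move: (ltn_ord x) (ltn_ord y); rewrite /q; case: j => [|[|[|]]] //; lia.
have q0 : (0 < q)%N by [].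
pose pt (j : nat) (t : grid k r.+1 * grid k r.+1) : grid k q :=
  [ffun i => insubd (Ordinal q0) (t.1 i + j * t.2 i)%N].
have ptE j t i : (j <= 2)%N -> pt j t i = (t.1 i + j * t.2 i)%N :> nat.
  by move=> j2; rewrite ffunE val_insubd ub.
pose f t := (pt 0%N t, pt 1%N t, pt 2 t).
have fi : injective f.
  move=> [a l] [a' l'] [/ffunP e0 /ffunP e1 _]; congr pair; apply/ffunP => i;
    apply/val_inj; move: (congr1 val (e0 i)) (congr1 val (e1 i));
    by rewrite /= !ptE //=; lia.
have <- : #|setX [set: grid k r.+1] s| = (r.+1 ^ k * #|s|)%N.
  by rewrite cardsX cardsT card_ffun !card_ord.
rewrite -(card_imset _ fi); apply/subset_leq_card/subsetP => t.
case/imsetP => -[a l]; rewrite !inE /= => /eqP lm ->.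
apply/andP; split.
  by apply/forallP => i; rewrite !ptE //=; lia.
rewrite /sqdist -lm (big_morph Posz PoszD (erefl _)); apply/eqP.
apply: eq_bigr => i _; rewrite !ptE //= mul0n mul1n addn0 PoszD addrAC subrr add0r.
by rewrite -rmorphXn.
Qed.

Lemma behrend_triples (k : nat) : (0 < k)%N ->
  exists (A : finType) (F : A -> A -> A -> bool),
    [/\ (2 ^ (k ^ 2) <= #|A|)%N,
        (#|A| ^ 3 <= 2 ^ (k ^ 2 + 8 * k)
           * #|[set t : A * A * A | F t.1.1 t.1.2 t.2]|)%N,
        forall a b c c', F a b c -> F a b c' -> c' = c &
        forall a b c a' b' c', F a b c -> F a' b c' -> F a b' c' ->
          [/\ a' = a, b' = b & c' = c]].
Proof.
move=> k0; set r := (2 ^ k)%N; have r0 : (0 < r)%N by rewrite expn_gt0.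
have [m hm] := popular_sphere k0 r0.
have hF := @card_sphere_prog k r m.
exists (grid k (3 * r) : finType), (sphere_prog m%:Z).
have cA : #|{: grid k (3 * r)}| = ((3 * r) ^ k)%N.
  by rewrite card_ffun !card_ord.
rewrite cA; split.
- by rewrite /r expnMn -expnM -mulnn -[X in (X <= _)%N]mul1n leq_mul // expn_gt0.
- move: hm hF; set y := #|[set l : grid k r | _]|; set x := #|_| => hm hF.
  (* The ratio of [#|A| ^ 3 = 27 ^ k * r ^ (3 * k)] to the number of triples is at most the left
     side. With [r = 2 ^ k] its factors are at most [2 ^ (5 * k)], [2 ^ (k + 2 * k)] and
     [2 ^ (k * k)]. *)
  have kr : (27 ^ k * (k * r ^ 2) * r ^ k <= 2 ^ (k ^ 2 + 8 * k))%N.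
    have -> : (k ^ 2 + 8 * k = 5 * k + (k + k * 2) + k * k)%N by nia.
    have k2 : (k <= 2 ^ k)%N by rewrite ltnW // ltn_expl.
    have k27 : (27 ^ k <= 2 ^ (5 * k))%N by rewrite expnM leq_exp2r.
    by rewrite [X in (_ <= X)%N]expnD leq_mul // ?/r -?expnM // expnD leq_mul //
      expnD expnM leq_mul.
  apply: leq_trans (leq_mul kr (leqnn _)).
  have -> : (((3 * r) ^ k) ^ 3 = 27 ^ k * r ^ k * (r ^ k * r ^ k))%N.
    have -> : (27 ^ k = (3 ^ k) ^ 3)%N by rewrite -expnM mulnC expnM.
    by rewrite (expnMn 3 r k); lia.
  move: hm hF; move: (27 ^ k)%N (k * r ^ 2)%N (r ^ k)%N => u v z h1 h2.
  have : (u * z * (z * z) <= u * z * (z * (v * y)))%N.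
    by rewrite leq_mul // leq_mul.
  have : (u * z * v * (z * y) <= u * z * v * x)%N by rewrite leq_mul.
  nia.
- exact: sphere_prog_third.
- exact: sphere_prog_triforce.
Qed.
End Behrend.

(** * The random coloured set: expectations and bounded differences *)

Section RandomSet.
Set Implicit Arguments.
Unset Strict Implicit.
Variables (R : realType) (G : finZmodType) (A : finType).
Variable F : A -> A -> A -> bool.
Hypothesis F_third : forall a b c c', F a b c -> F a b c' -> c' = c.
Hypothesis F_triforce : forall a b c a' b' c',
  F a b c -> F a' b c' -> F a b' c' -> [/\ a' = a, b' = b & c' = c].
Hypothesis A_gt0 : (0 < #|A|)%N.

Notation coord := ((G + G + G)%type).
Notation colouring := {ffun coord -> A}.
Implicit Types (w : colouring) (d e x y z : G).

(** Three disjoint copies of [G] index the values of f, g and h, so that the three random maps form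
    a single point of a product space. *)
Definition Xc x : coord := inl (inl x).
Definition Yc y : coord := inl (inr y).
Definition Zc z : coord := inr z.

Definition coloured_set w : {set G * G} :=
  [set p | F (w (Xc p.1)) (w (Yc p.2)) (w (Zc (p.1 + p.2)))].

Definition pattern_density (S : {set G * G}) d e1 e2 : R :=
  average (fun p : G * G =>
    indicator R S (p.1, p.2) * indicator R S (p.1 + d, p.2) *
    indicator R S (p.1, p.2 + d) * indicator R S (p.1 + e1, p.2 + e2)).

Lemma card_G_gt0 : (0 < #|G|)%N.
Proof. by apply/card_gt0P; exists 0. Qed.

Lemma card_GG_gt0 : (0 < #|{: G * G}|)%N.
Proof. by apply/card_gt0P; exists 0. Qed.

(** The function c of the pair; [a] is only a default for pairs that no triple of [F] extends. *)
Definition third a b := odflt a [pick c | F a b c].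

Lemma thirdP a b c : F a b c -> c = third a b.
Proof.
rewrite /third => abc; case: pickP => [c' /= abc'|/(_ c)]; last by rewrite abc.
exact: F_third abc' abc.
Qed.

(* The pattern in the coloured set forces five coordinates to be functions of
   the others; each costs a factor #|A|. *)
Lemma expected_pattern_density d e1 e2 :
    d <> 0 -> e1 + e2 <> 0 -> e1 + e2 <> d ->
  average (fun w => pattern_density (coloured_set w) d e1 e2)
    <= (#|A|%:R ^+ 5)^-1.
Proof.
move=> d0 e0 ed; rewrite /pattern_density exchange_average.
rewrite -[leRHS](average_cst _ card_GG_gt0); apply: ler_average => -[x y] /=.
have nX : (Xc x == Xc (x + d)) = false.
  by apply/eqP => -[] /eqP; rewrite -[X in X == _]addr0 (inj_eq (addrI x)) => /eqP/esym.
have nY : (Yc y == Yc (y + d)) = false.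
  by apply/eqP => -[] /eqP; rewrite -[X in X == _]addr0 (inj_eq (addrI y)) => /eqP/esym.
have nZ1 : (Zc (x + y) == Zc (x + y + d)) = false.
  by apply/eqP => -[] /eqP; rewrite -[X in X == _]addr0 (inj_eq (addrI _)) => /eqP/esym.
have nZ2 : (Zc (x + y) == Zc (x + y + (e1 + e2))) = false.
  by apply/eqP => -[] /eqP; rewrite -[X in X == _]addr0 (inj_eq (addrI _)) => /eqP/esym.
have nZ3 : (Zc (x + y + d) == Zc (x + y + (e1 + e2))) = false.
  by apply/eqP => -[] /eqP; rewrite (inj_eq (addrI _)) => /eqP/esym.
(* [v1] is the value forced on h by the fourth point, [v2] the one forced by the corner. *)
pose v1 w := third (w (Xc (x + e1))) (w (Yc (y + e2))).
pose v2 w := third (w (Xc x)) (w (Yc y)).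
(* The order matters: each tested coordinate is read neither by its target value nor by the factors
   to its right. The Z coordinates go first because [v1] may read the X or Y coordinates tested
   later. *)
apply: (@le_trans _ _ (average (fun w =>
    (w (Zc (x + y + (e1 + e2))) == v1 w)%:R *
    ((w (Zc (x + y + d)) == v2 w)%:R *
    ((w (Zc (x + y)) == v2 w)%:R *
    ((w (Yc (y + d)) == w (Yc y))%:R *
    ((w (Xc (x + d)) == w (Xc x))%:R * 1)))) : R))).
  apply: ler_average => w; rewrite /indicator !inE /=.
  have -> : x + d + y = x + y + d by rewrite addrAC.
  have -> : x + (y + d) = x + y + d by rewrite addrA.
  have -> : x + e1 + (y + e2) = x + y + (e1 + e2) by rewrite addrACA.
  case f1: (F (w (Xc x)) _ _); last by rewrite !mul0r !mulr_ge0.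
  case f2: (F (w (Xc (x + d))) _ _); last by rewrite mulr0 !mul0r !mulr_ge0.
  case f3: (F (w (Xc x)) _ _); last by rewrite mulr0 !mul0r !mulr_ge0.
  case f4: (F _ _ _); last by rewrite !mulr0 !mulr_ge0.
  have [-> -> ->] := F_triforce f1 f2 f3.
  by rewrite (thirdP f4) (thirdP f1) !eqxx !mulr1.
do 4! [rewrite average_determined //;
  last (by move=> w a; rewrite /v1 /v2 !updateE ?nX ?nY ?nZ1 ?nZ2 ?nZ3);
  last (by move=> w a; rewrite /v1 /v2 !updateE ?nX ?nY ?nZ1 ?nZ2 ?nZ3)].
rewrite average_determined //; last by move=> w a; rewrite updateE nX.
rewrite average_cst; last first.
  by have /card_gt0P[a _] := A_gt0; apply/card_gt0P; exists [ffun=> a].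
by rewrite mulr1 !exprS expr0 mulr1 !invfM.
Qed.

(** For fixed [(x, y)] the three coordinates read lie in different copies of [G], so their colours
    are independent and uniform on [A]. *)
Lemma expected_density :
  average (fun w => average (indicator R (coloured_set w)))
    = #|[set t : A * A * A | F t.1.1 t.1.2 t.2]|%:R / #|A|%:R ^+ 3.
Proof.
rewrite exchange_average -[RHS](average_cst _ card_GG_gt0).
apply: eq_average => -[x y]; rewrite -(average_marginal (Zc (x + y))) //.
rewrite -(average_marginal (Yc y)) // -(average_marginal (Xc x)) //.
have -> : #|[set t : A * A * A | F t.1.1 t.1.2 t.2]|%:R / #|A|%:R ^+ 3
    = average (fun t : A * A * A => (F t.1.1 t.1.2 t.2)%:R) :> R.
  rewrite /average !card_prod; congr (_ / _); last by rewrite !natrM !exprS mulr1 mulrA.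
  rewrite -sum1_card natr_sum big_mkcond /=; apply: eq_bigr => t _.
  by rewrite inE; case: ifP.
rewrite -[RHS](@average_cst _ colouring); last first.
  by have /card_gt0P[a _] := A_gt0; apply/card_gt0P; exists [ffun=> a].
apply: eq_average => w; rewrite average_prod average_prod /marginal.
by do 3! [apply: eq_average => ?]; rewrite /indicator !inE /= !updateE !eqxx.
Qed.

(** One coordinate influences only the points of one line, [x = z], [y = z] or [x + y = z], and such
    a line has density [1 / #|G|]. *)
Lemma coloured_set_update w q a :
  average (fun p => `|indicator R (coloured_set (update w q a)) p -
                      indicator R (coloured_set w) p|) <= #|G|%:R^-1.
Proof.
have bool_diff (b1 b2 : bool) : `|b1%:R - b2%:R| <= 1 :> R.
  by case: b1; case: b2; rewrite ?subrr ?subr0 ?sub0r ?normrN ?normr0 ?normr1.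
have line (f : G * G -> bool) : average (fun p => (f p)%:R) = #|G|%:R^-1 :> R ->
    (forall p, ~~ f p -> (p \in coloured_set (update w q a)) = (p \in coloured_set w)) ->
    average (fun p => `|indicator R (coloured_set (update w q a)) p -
                        indicator R (coloured_set w) p|) <= #|G|%:R^-1.
  move=> <- fP; apply: ler_average => p; rewrite /indicator.
  by case: (boolP (f p)) => [_|/fP ->]; rewrite ?subrr ?normr0.
case: q line => [[z|z]|z] line.
- apply: (line (fun p => p.1 == z)) => [|p pz]; last first.
    by rewrite !inE !updateE [_ == _](negbTE pz).
  rewrite average_prod /= -(average_eq1 R z); apply: eq_average => x.
  by rewrite average_cst // card_G_gt0.
- apply: (line (fun p => p.2 == z)) => [|p pz]; last first.
    by rewrite !inE !updateE [Yc _ == _](negbTE pz).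
  by rewrite average_prod /= average_eq1 average_cst // card_G_gt0.
- apply: (line (fun p => p.1 + p.2 == z)) => [|p pz]; last first.
    by rewrite !inE !updateE [Zc _ == _](negbTE pz).
  rewrite average_prod /= -[RHS](average_cst _ card_G_gt0); apply: eq_average => x.
  rewrite -(average_eq1 R (z - x)); apply: eq_average => y.
  by rewrite [y == _]eq_sym subr_eq addrC eq_sym.
Qed.

Lemma bounded_diff_density :
  bounded_diff #|G|%:R^-1 (fun w => average (indicator R (coloured_set w))).
Proof.
move=> w q a; rewrite -averageB; apply: le_trans (ler_norm_average _) _.
exact: coloured_set_update.
Qed.

Lemma ler_dist_mul (x y x' y' : R) : 0 <= x <= 1 -> 0 <= y' <= 1 ->
  `|x * y - x' * y'| <= `|x - x'| + `|y - y'|.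
Proof.
move=> /andP[x0 x1] /andP[y0 y1].
have -> : x * y - x' * y' = (x - x') * y' + x * (y - y') by ring.
apply: le_trans (ler_normD _ _) _; rewrite !normrM (ger0_norm x0) (ger0_norm y0).
by rewrite lerD // ?ler_piMr ?ler_piMl.
Qed.

(** The four indicators are replaced one after the other; each costs a translate of the change of
    the set, and averages are translation invariant. *)
Lemma bounded_diff_pattern_density d e1 e2 :
  bounded_diff (4 / #|G|%:R) (fun w => pattern_density (coloured_set w) d e1 e2).
Proof.
move=> w q a; rewrite -averageB; apply: le_trans (ler_norm_average _) _.
pose D p : R := `|indicator R (coloured_set (update w q a)) p -
                  indicator R (coloured_set w) p|.
have D_shift u v : average (fun p : G * G => D (p.1 + u, p.2 + v)) <= #|G|%:R^-1.
  rewrite (@reindex_average _ _ (fun p : G * G => (p.1 + u, p.2 + v)) D).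
    exact: coloured_set_update.
  by move=> [x y] [x' y'] /= [/addIr -> /addIr ->].
have ind01 S p : 0 <= indicator R S p <= 1.
  by rewrite /indicator; case: (p \in S); rewrite ?lexx ?ler01.
have mul01 (x y : R) : 0 <= x <= 1 -> 0 <= y <= 1 -> 0 <= x * y <= 1.
  move=> /andP[x0 x1] /andP[y0 y1]; rewrite mulr_ge0 //=.
  by rewrite -[leRHS]mulr1 ler_pM.
apply: (@le_trans _ _ (average (fun p : G * G => D (p.1 + 0, p.2 + 0) +
    D (p.1 + d, p.2 + 0) + D (p.1 + 0, p.2 + d) + D (p.1 + e1, p.2 + e2)))).
  apply: ler_average => p; rewrite !addr0.
  do 2! [apply: le_trans (ler_dist_mul _ _ _ _) _;
         [by rewrite !mul01|by []|rewrite lerD2r]].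
  exact: ler_dist_mul.
rewrite !averageD.
by move: (D_shift 0 0) (D_shift d 0) (D_shift 0 d) (D_shift e1 e2); lra.
Qed.
End RandomSet.

(** * Union bound, choice of parameters, and the theorem *)

Section Main.
Set Implicit Arguments.
Unset Strict Implicit.
Variable R : realType.

Lemma succ_lt_expR (c x : R) : 0 < c -> 0 < x -> 4 < c ^+ 2 * x ->
  x + 1 < expR (c * x).
Proof.
move=> c0 x0 h; have cx : 0 < c * x by rewrite mulr_gt0.
have -> : c * x = c * x / 2 + c * x / 2 by lra.
rewrite expRD; have e1 := expR_ge1Dx (c * x / 2).
apply: lt_le_trans (_ : (1 + c * x / 2) * (1 + c * x / 2) <= _); last first.
  by rewrite ler_pM //; lra.
have : 4 * x < c ^+ 2 * x * x by rewrite ltr_pM2r.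
nra.
Qed.

(* Markov's inequality for the exponential moments, summed over all d. *)
Lemma sparse_pattern_set (G : finZmodType) (A : finType)
    (F : A -> A -> A -> bool) (e1 e2 : G -> G) :
  let eta : R := (#|A|%:R ^+ 5)^-1 in
  let beta : R := #|[set t : A * A * A | F t.1.1 t.1.2 t.2]|%:R / #|A|%:R ^+ 3 in
  (forall a b c c', F a b c -> F a b c' -> c' = c) ->
  (forall a b c a' b' c', F a b c -> F a' b c' -> F a b' c' ->
     [/\ a' = a, b' = b & c' = c]) ->
  (0 < #|A|)%N -> 2 * eta <= beta ->
  4 < (eta ^+ 2 / 384) ^+ 2 * #|G|%:R ->
  (forall d, d <> 0 -> e1 d + e2 d <> 0 /\ e1 d + e2 d <> d) ->
  exists S : {set G * G}, beta / 2 * #|G|%:R ^+ 2 <= #|S|%:R /\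
    forall d, d <> 0 -> pattern_density R S d (e1 d) (e2 d) < 2 * eta.
Proof.
move=> eta beta F3 Ft A0 eta_beta G_big e12.
have n1 : 1 <= #|A|%:R :> R by rewrite ler1n.
have eta0 : 0 < eta by rewrite invr_gt0 exprn_gt0 // ltr0n.
have eta1 : eta <= 1 by rewrite invf_le1 ?exprn_ege1 // exprn_gt0 // ltr0n.
have N0 : 0 < #|G|%:R :> R by rewrite ltr0n card_G_gt0.
set N : R := #|G|%:R in G_big N0 *.
(* With [3 N] coordinates and differences [4 t], the exponent is [N (96 t^2 - t eta)]; this [t]
   minimises it, with value [- eta^2 N / 384]. *)
pose t := eta / 192; pose lam := t * N.
have t0 : 0 < t by rewrite divr_gt0.
have lam0 : 0 < lam by rewrite mulr_gt0.
pose T d w := pattern_density R (coloured_set F w) d (e1 d) (e2 d).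
pose D (w : {ffun G + G + G -> A}) := average (indicator R (coloured_set F w)).
have W0 : (0 < #|{ffun G + G + G -> A}|)%N.
  by have /card_gt0P[a _] := A0; apply/card_gt0P; exists [ffun=> a].
have moment (phi : {ffun G + G + G -> A} -> R) m :
    bounded_diff (4 / N) phi -> average phi <= m - eta ->
    average (fun w => expR (lam * (phi w - m))) <= expR (- (eta ^+ 2 / 384 * N)).
  move=> phib phim; apply: le_trans (@mcdiarmid_expR _ _ _ (4 * t) _ A0 _ _) _.
  - by rewrite /t; lra.
  - move=> w p a; rewrite -mulrBr opprB addrA subrK normrM (gtr0_norm lam0).
    apply: le_trans (ler_wpM2l (ltW lam0) (phib w p a)) _.
    have -> // : lam * (4 / N) = 4 * t by rewrite /lam; field; rewrite gt_eqF.
  rewrite -expRD ler_expR averageZ averageB average_cst //.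
  rewrite !card_sum -addnA !natrD -/N.
  have : lam * (average phi - m) <= lam * - eta by rewrite ler_pM2l //; lra.
  rewrite /lam /t; nra.
have momentT d : d <> 0 ->
    average (fun w => expR (lam * (T d w - 2 * eta))) <= expR (- (eta ^+ 2 / 384 * N)).
  move=> d0; have [e0 ed] := e12 d d0; apply: moment.
    exact: bounded_diff_pattern_density.
  apply: le_trans (expected_pattern_density _ F3 Ft A0 d0 e0 ed) _.
  by rewrite -/eta; lra.
(* The lower tail of [D] is treated as an upper tail of [- D]; the gap [beta / 2] is at least
   [eta]. *)
have momentD :
    average (fun w => expR (lam * (- D w - - (beta / 2)))) <= expR (- (eta ^+ 2 / 384 * N)).
  apply: moment.
    move=> w p a; rewrite opprK addrC distrC.
    apply: le_trans (bounded_diff_density R F w p a) _.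
    by rewrite ler_peMl ?invr_ge0 ?ltW //; lra.
  have -> : average (fun w => - D w) = - beta.
    rewrite /beta -(expected_density R G F A0) -[RHS]mulN1r -averageZ.
    by apply: eq_average => w; rewrite mulN1r.
  lra.
(* All terms are positive, and a violated requirement would make its term at least 1; hence
   [Phi w < 1] certifies every requirement at once. *)
pose Phi w := \sum_(d | d != 0) expR (lam * (T d w - 2 * eta)) +
              expR (lam * (- D w - - (beta / 2))).
have [w Phiw] : exists w, Phi w < 1.
  apply: average_lt1 => //; rewrite averageD average_sum.
  apply: (@le_lt_trans _ _ ((N + 1) * expR (- (eta ^+ 2 / 384 * N)))).
    rewrite [(N + 1) * _]mulrDl mul1r lerD //.
    apply: le_trans (ler_sum _ (fun d dn0 => momentT d (elimN eqP dn0))) _.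
    rewrite sumr_const -[leLHS]mulr_natl ler_wpM2r ?expR_ge0 // ler_nat.
    exact: max_card.
  rewrite expRN ltr_pdivrMr ?expR_gt0 // mul1r succ_lt_expR //.
  by rewrite divr_gt0 // exprn_gt0.
have expR_lt1 (x : R) : expR x < 1 -> x < 0 by rewrite -expR0 ltr_expR.
exists (coloured_set F w); split.
  have : expR (lam * (- D w - - (beta / 2))) < 1.
    apply: le_lt_trans Phiw; rewrite lerDr sumr_ge0 // => d _; exact: expR_ge0.
  move/expR_lt1; rewrite pmulr_rlt0 // => hD.
  have DE : D w * N ^+ 2 = #|coloured_set F w|%:R.
    rewrite /D /average card_prod natrM -/N expr2 mulfVK; last first.
      by rewrite mulf_neq0 ?gt_eqF.
    rewrite -sum1_card natr_sum [RHS]big_mkcond /=; apply: eq_bigr => p _.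
    by rewrite /indicator; case: ifP.
  by rewrite -DE ler_wpM2r ?exprn_ge0 ?ltW //; lra.
move=> d /eqP d0.
have : expR (lam * (T d w - 2 * eta)) < 1.
  apply: le_lt_trans Phiw; rewrite /Phi (bigD1 d) //= -addrA lerDl addr_ge0 ?expR_ge0 //.
  by rewrite sumr_ge0 // => ? _; exact: expR_ge0.
by move/expR_lt1; rewrite pmulr_rlt0 // subr_lt0.
Qed.

Lemma mulrz_coprime_eq0 (G : finZmodType) (d : G) (m : int) :
  coprime `|m| #|G| -> d *~ m = 0 -> d = 0.
Proof.
move=> cop dm; have {dm} : d *+ `|m|%N = 0.
  by case: m dm {cop} => m //=; rewrite NegzE mulrNz => /eqP; rewrite oppr_eq0 => /eqP.
rewrite -FinRing.zmodXgE => dm.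
have coG : coprime #|[set: G]| `|m| by rewrite coprime_sym cardsT.
rewrite -[d](expgK coG) ?inE // dm -[0]/(1%g : G) expg1n.
by [].
Qed.

(** As [ln 2 <= 1], the hypothesis gives [ln (1 / alpha) >= j^2 ln 2 >= (j ln 2)^2]. *)
Lemma exp2_le_expR_sqrt_ln (alpha : R) (j m : nat) :
  0 < alpha -> alpha <= (2 ^+ (j ^ 2))^-1 ->
  2 ^+ (m * j) <= expR (m%:R * Num.sqrt (ln (1 / alpha))).
Proof.
move=> a0 aj; have l2 : 0 <= ln 2 :> R by rewrite ln_ge0 // ler1n.
have l21 : ln 2 <= 1 :> R.
  have := @le_ln1Dx R 1; rewrite -[1 + 1]/(2 : R); apply; lra.
have -> : 2 ^+ (m * j) = expR (m%:R * (j%:R * ln 2)) :> R.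
  by rewrite mulrA -natrM mulrC expRM_natr lnK // posrE ltr0n.
rewrite ler_expR ler_wpM2l //.
have jl : 0 <= j%:R * ln 2 :> R by rewrite mulr_ge0.
rewrite -[leLHS]ger0_norm // -sqrtr_sqr ler_wsqrtr //.
apply: (@le_trans _ _ (ln (2 ^+ (j ^ 2)))).
  rewrite lnXn ?ltr0n // -[ln 2 *+ _]mulr_natl exprMn natrX ler_wpM2l ?exprn_ge0 //.
  by rewrite expr2 ler_piMl.
rewrite ler_ln ?posrE ?exprn_gt0 ?ltr0n // ?divr_gt0 //.
by rewrite div1r -[leLHS]invrK lef_pV2 ?posrE ?invr_gt0 ?exprn_gt0 ?ltr0n.
Qed.

(** Selects the Behrend dimension [j] as the least one possible; [j = 0] means that [alpha] exceeds
    [2^-10]. *)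
Lemma power2_bracket (alpha : R) : 0 < alpha ->
  exists j : nat, (2 ^+ (j.+1 ^ 2 + 9 * j.+1))^-1 < alpha /\
    ((0 < j)%N -> alpha <= (2 ^+ (j ^ 2 + 9 * j))^-1).
Proof.
move=> a0.
have ex : exists j : nat, (2 ^+ (j.+1 ^ 2 + 9 * j.+1))^-1 < alpha.
  exists (Num.bound alpha^-1).
  rewrite -[ltRHS]invrK ltf_pV2 ?posrE ?invr_gt0 ?exprn_gt0 ?ltr0n //.
  apply: lt_trans (archi_boundP (ltW _)) _; first by rewrite invr_gt0.
  rewrite -natrX ltr_nat; apply: leq_trans (ltn_expl _ (ltnSn 1)) _.
  by rewrite leq_exp2l //; nia.
case: (ex_minnP ex) => j hj jmin; exists j; split => // j0.
rewrite leNgt; apply/negP => lt_j; case: j j0 {hj} jmin lt_j => // j _ jmin lt_j.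
by have := jmin _ lt_j; rewrite ltnn.
Qed.

Lemma sparse_density_bounds (alpha : R) (A : finType) (F : A -> A -> A -> bool)
    (j : nat) :
  let eta : R := (#|A|%:R ^+ 5)^-1 in
  let beta : R := #|[set t : A * A * A | F t.1.1 t.1.2 t.2]|%:R / #|A|%:R ^+ 3 in
  0 < alpha -> (0 < j)%N ->
  (2 ^+ (j.+1 ^ 2 + 9 * j.+1))^-1 < alpha -> alpha <= (2 ^+ (j ^ 2 + 9 * j))^-1 ->
  (2 ^ (j ^ 2) <= #|A|)%N ->
  (#|A| ^ 3 <= 2 ^ (j ^ 2 + 8 * j)
     * #|[set t : A * A * A | F t.1.1 t.1.2 t.2]|)%N ->
  [/\ 2 * eta <= beta, alpha <= beta / 2 &
      2 * eta <= alpha ^+ 5 * expR (106 * Num.sqrt (ln (1 / alpha)))].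
Proof.
move=> eta; set f := #|[set t | _]|; move=> beta a0 j0 a_gt a_le nA hF.
have two0 m : 0 < 2 ^+ m :> R by rewrite exprn_gt0 // ltr0n.
have A2 : (2 <= #|A|)%N.
  by apply: leq_trans nA; rewrite -[X in (X <= _)%N]expn1 leq_exp2l // expn_gt0 j0.
have A0 : 0 < #|A|%:R :> R by rewrite ltr0n ltnW.
have n3 : 0 < #|A|%:R ^+ 3 :> R by rewrite exprn_gt0.
have f0 : (0 < f)%N.
  case: (posnP f) => // f0; move: hF.
  by rewrite f0 muln0 leqn0 expn_eq0 /= -leqn0 leqNgt ltnW.
split.
- rewrite /eta /beta ler_pdivlMr // (exprD _ 2 3) invfM -!mulrA mulVf ?gt_eqF //.
  rewrite mulr1 ler_pdivrMr ?exprn_gt0 //.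
  have h1 : 1 <= f%:R :> R by rewrite ler1n.
  have h2 : 2 <= #|A|%:R :> R by rewrite ler_nat.
  nra.
- apply: le_trans a_le _; rewrite /beta ler_pdivlMr // ler_pdivlMr //.
  have -> : (j ^ 2 + 9 * j = j ^ 2 + 8 * j + j)%N by lia.
  have : #|A|%:R ^+ 3 <= 2 ^+ (j ^ 2 + 8 * j) * f%:R :> R.
    by rewrite -!natrX -natrM ler_nat.
  (* The exponent [9 * j] exceeds Behrend's [8 * j] by [j], and [2 ^+ j >= 2] pays for halving
     [beta]. *)
  rewrite [in X in _ -> X]exprD; set u := 2 ^+ (j ^ 2 + 8 * j).
  have u0 : 0 < u by apply: two0.
  have v2 : 2 <= 2 ^+ j :> R by rewrite -[leLHS]expr1 ler_weXn2l // ler1n.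
  move=> h; rewrite -mulrA ler_pdivrMl ?mulr_gt0 //.
  apply: (@le_trans _ _ (2 * (u * f%:R))); first by rewrite ler_pM2l ?ltr0n.
  by rewrite -[leRHS]mulrA mulrCA ler_wpM2l ?(ltW u0) // ler_wpM2r.
- have e1 : eta <= (2 ^+ (5 * j ^ 2))^-1.
    rewrite /eta lef_pV2 ?posrE ?exprn_gt0 // mulnC exprM lerXn2r ?nnegrE ?(ltW (two0 _)) //.
    by rewrite -natrX ler_nat.
  apply: (@le_trans _ _ (2 * (2 ^+ (5 * j ^ 2))^-1)); first by rewrite ler_pM2l.
  (* Origin of 106: the exponents require [1 + 5 (j^2 + 11 j + 10) <= 5 j^2 + 106 j], that is
     [51 <= 51 j]. *)
  apply: (@le_trans _ _ (((2 ^+ (j.+1 ^ 2 + 9 * j.+1))^-1) ^+ 5 * 2 ^+ (106 * j))).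
    rewrite exprVn -exprM ler_pdivlMl // mulrA ler_pdivrMr // -exprSr -exprD.
    by rewrite ler_weXn2l ?ler1n //; nia.
  apply: ler_pM; [by rewrite exprn_ge0 // invr_ge0 ltW|exact: ltW| |].
    by rewrite lerXn2r ?nnegrE ?invr_ge0 ?ltW.
  apply: exp2_le_expR_sqrt_ln => //; apply: le_trans a_le _.
  by rewrite lef_pV2 ?posrE // ler_weXn2l ?ler1n // leq_addr.
Qed.

(** Multiplying the sum by [b] gives [s] times [d], so a coincidence would make [s] or [s - b], both
    coprime to the order of [G], annihilate [d]. *)
Lemma ratmul_sum_neq (G : finZmodType) (k1 k2 : rat) (d : G) :
  let s := numq k1 * denq k2 + numq k2 * denq k1 in
  let b := denq k1 * denq k2 in
  coprime #|G| (absz (b * s * (s - b))) -> d <> 0 ->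
  ratmul k1 d + ratmul k2 d <> 0 /\ ratmul k1 d + ratmul k2 d <> d.
Proof.
move=> s b; rewrite !abszM !coprimeMr => /andP[/andP[/andP[c1 c2] cs] csb] d0.
have E : (ratmul k1 d + ratmul k2 d) *~ b = d *~ s.
  rewrite mulrzDl /b mulrzA ratmulP 1?coprime_sym // [_ * denq k2]mulrC mulrzA.
  rewrite ratmulP 1?coprime_sym // /s -!mulrzA -mulrzDr.
  by [].
split=> e12; apply: d0.
  by apply: (@mulrz_coprime_eq0 _ _ s); rewrite 1?coprime_sym // -E e12 mul0rz.
apply: (@mulrz_coprime_eq0 _ _ (s - b)); first by rewrite coprime_sym.
by rewrite mulrzBr -E e12 subrr.
Qed.
End Main.

Theorem theorem3p1 (R : realType) (k1 k2 : rat)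
    (k1_gt0 : 0 < k1) (k2_gt0 : 0 < k2) (k1k2_neq1 : k1 + k2 <> 1) :
  exists (C : R) (M : nat),
    [/\ 0 < C, (0 < M)%N, (`|denq k1| %| M)%N, (`|denq k2| %| M)%N &
      forall alpha : R, 0 < alpha -> alpha < 1 / 2 ->
      exists N0 : nat, forall G : finZmodType,
        (N0 < #|G|)%N -> coprime #|G| M ->
        exists S : {set G * G},
          alpha * #|G|%:R ^+ 2 <= #|S|%:R /\
          forall d : G, d <> 0 ->
            average (fun p : G * G =>
              indicator R S (p.1, p.2) *
              indicator R S (p.1 + d, p.2) *
              indicator R S (p.1, p.2 + d) *
              indicator R S (p.1 + ratmul k1 d, p.2 + ratmul k2 d))
            < alpha ^+ 5 * expR (C * Num.sqrt (ln (1 / alpha)))].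
Proof.
pose s : int := numq k1 * denq k2 + numq k2 * denq k1.
pose b : int := denq k1 * denq k2.
have s_gt0 : 0 < s by rewrite addr_gt0 // mulr_gt0 ?numq_gt0 ?denq_gt0.
have sb : s - b != 0.
  rewrite subr_eq0; apply/eqP => sbE; apply: k1k2_neq1.
  rewrite -[k1]divq_num_den -[k2]divq_num_den addf_div ?intr_eq0 ?denq_eq0 //.
  rewrite -!intrM -intrD -/s -/b sbE divff // intr_eq0 mulf_neq0 ?denq_neq0 //.
(* Here [k1 + k2 = s / b]: besides the denominators, [M] must contain [s] and [s - b], nonzero by
   the hypotheses on [k1] and [k2]. *)
exists 106, (absz (b * s * (s - b))); split.
- by rewrite ltr0n.
- by rewrite absz_gt0 !mulf_neq0 ?denq_neq0 // gt_eqF.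
- by rewrite /b !abszM -!mulnA dvdn_mulr.
- by rewrite /b !abszM -!mulnA dvdn_mull // dvdn_mulr.
move=> alpha a0 a12; have [j [j_gt j_le]] := @power2_bracket R alpha a0.
case: j j_gt j_le => [|j] j_gt j_le.
  (* For [alpha > 2^-10] the whole of [G * G] works: as [alpha < 1 / 2], the right side is at least
     [2^-50 * 2^106 > 1]. *)
  exists 0%N => G _ _; exists [set: G * G]; split.
    rewrite cardsT card_prod natrM -expr2 ler_piMl ?exprn_ge0 //.
    by apply: ltW; apply: lt_trans a12 _; lra.
  move=> d _; apply: (@le_lt_trans _ _ 1).
    rewrite -[leRHS](@average_cst R (G * G)%type); last exact: card_GG_gt0.
    by apply: ler_average => p; rewrite /indicator !inE !mulr1.
  apply: (@lt_le_trans _ _ (((2 ^+ 10)^-1) ^+ 5 * 2 ^+ (106 * 1))).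
    rewrite exprVn -exprM ltr_pdivlMl ?exprn_gt0 ?ltr0n // mulr1.
    by rewrite ltr_eXn2l // ltr1n.
  apply: ler_pM; rewrite ?exprn_ge0 ?invr_ge0 ?exprn_ge0 //.
    by rewrite lerXn2r ?nnegrE ?invr_ge0 ?exprn_ge0 ?ltW.
  apply: exp2_le_expR_sqrt_ln => //; rewrite expr1; lra.
have [A [F [nA hF F3 Ft]]] := @behrend_triples j.+1 isT.
have [eta_beta a_beta eta_alpha] :=
  sparse_density_bounds a0 (ltn0Sn j) j_gt (j_le isT) nA hF.
have A0 : (0 < #|A|)%N by apply: leq_trans nA; rewrite expn_gt0.
set eta : R := (#|A|%:R ^+ 5)^-1 in eta_beta eta_alpha.
pose c := (eta ^+ 2 / 384) ^+ 2.
have c0 : 0 < c by rewrite !(exprn_gt0, divr_gt0, invr_gt0) // ltr0n.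
(* [A] was chosen from [j] alone, so this threshold does not depend on the group. *)
exists (Num.bound (4 / c)) => G hG cop.
have G_big : 4 < c * #|G|%:R.
  rewrite mulrC -ltr_pdivrMr //; apply: lt_trans (archi_boundP _) _.
    by rewrite divr_ge0 // ltW.
  by rewrite ltr_nat.
have [S [S_ge S_lt]] := @sparse_pattern_set R G A F (ratmul k1) (ratmul k2)
  F3 Ft A0 eta_beta G_big (fun d d0 => ratmul_sum_neq cop d0).
exists S; split; first by apply: le_trans S_ge; rewrite ler_wpM2r ?exprn_ge0.
by move=> d d0; apply: lt_le_trans eta_alpha; apply: S_lt.
Qed.
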